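(* For all real numbers $\alpha, \beta \in (0,1]$ there exists a positive integer $k_0 = k_0(\alpha,\beta)$ such that for all sets $E_1, E_2 \subset \mathbb{Z}$ with upper Banach densities $d^*(E_1) = \alpha$ and $d^*(E_2) = \beta$ there exists an integer $k$ with $1 \le k \le k_0$ such that \[ k\,\mathbb{Z} \subset (E_1 - E_1)\cdot(E_2 - E_2). \]
   Context: The upper Banach density of a set $E \subset \mathbb{Z}$ is $d^*(E) = \limsup_{N \to \infty} \sup_{a \in \mathbb{Z}} \frac{|E \cap \{a,a+1,\ldots,a+(N-1)\}|}{N}$. For $E \subset \mathbb{Z}$, $E - E = \{x - y \mid x,y \in E\}$; for $P,Q \subset \mathbb{Z}$, $P\cdot Q = \{pq \mid p \in P, q \in Q\}$; and $k\,\mathbb{Z} = \{kn \mid n \in \mathbb{Z}\}$. *)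

(* Defs.v *)
From HB Require Import structures.
From mathcomp Require Import all_boot all_order all_algebra finmap.
From mathcomp Require Import all_classical all_reals all_analysis.

Set Implicit Arguments.
Unset Strict Implicit.
Unset Printing Implicit Defensive.

Import Order.TTheory GRing.Theory Num.Theory.
Local Open Scope classical_set_scope.
Local Open Scope ring_scope.

Definition int_window (a : int) (N : nat) : set int :=
  [set x | a <= x <= a + (N%:Z - 1)].

(* [fset_set] would return the empty set on an infinite set, but windows are
   finite.  The term N = 0 (where 0 / 0 = 0) does not affect the limsup. *)
Definition upper_banach_density (R : realType) (E : set int) : \bar R :=
  limn_esup (fun N : nat =>
    ereal_sup [set ((#|` fset_set (E `&` int_window a N) |)%:R / N%:R : R)%:E
              | a in [set: int]]).

Definition diff_set (E : set int) : set int :=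
  [set x - y | x in E & y in E].

Definition prod_set (P Q : set int) : set int :=
  [set p * q | p in P & q in Q].

Definition multiples (k : int) : set int :=
  [set k * n | n in [set: int]].

(* Main.v *)
Require Import Defs.
From mathcomp Require Import all_boot all_order all_algebra finmap.
From mathcomp Require Import all_classical all_reals all_analysis.
From mathcomp Require Import ring lra zify.
Import Order.TTheory GRing.Theory Num.Theory.
Import numFieldNormedType.Exports.
Local Open Scope classical_set_scope.
Local Open Scope ring_scope.

(** Put E = E1 x E2, a subset of Z^2.  The integer K is a product of an element
    of E1 - E1 and an element of E2 - E2 exactly when some difference (x, y) of
    two points of E satisfies x y = K.  The hyperbola x y = K is preserved by
    the dilations (x, y) |-> (c x, y / c), and this symmetry carries the proof.

    Suppose that no k0 works.  For every j, let q be an integer divisible by all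
    numbers of interest at stage j.  Then q^2 fails as a value of k, so there
    are sets E1, E2 of the given densities and a nonzero n with q^2 n outside
    the product set.  Count the pairs of points of E, in long windows, that
    differ by (q x, n q y): this is a function of (x, y) which is positive
    definite, with a mass at the trivial character bounded below by the
    densities ([window_kernel]).  Average it over a large family of dilations by
    divisors c of q ([dilations_folner]).  The average still vanishes at (1, 1),
    because (q c) (n q / c) = q^2 n, and it is nearly invariant under small
    dilations ([approx_kernel]).  A limit along an ultrafilter is a positive
    definite function H on Q^2, exactly invariant under the dilations, with a
    positive mass d and with H(1, 1) = 0 ([limit_kernel]).

    Such an H does not exist, since H(1, 1) > 0 ([ker_11_gt0]).  View H as the
    Gram matrix <v_p, v_q> = H(p - q) of vectors indexed by Q^2.  By invariance
    H(x, y) depends only on g(x y) = H(1, x y) when x <> 0, and is constant for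
    x = 0, y <> 0.  So the vectors v_(0,y) form, up to a common component, an
    orthogonal family.  Bessel's inequality for their products with v_(1,0)
    shows that the averages of g over any two sets of N rationals differ by at
    most sqrt (2 / N) ([ker_bessel]); let L be this common approximate average.
    Take p_i on the hyperbola x y = 1 and q_j in general position.  Off the
    diagonal, the entries of the Gram matrix of the p_i and q_j average to L in
    every block, hence the means of the v_(p_i) and of the v_(q_j) are close in
    norm.  The first mean has
    product g(1) with v_0 and the second has product L, so g(1) is close to L,
    and L is at least d up to an error that tends to 0. *)

(** * Gram forms of translation kernels *)

(** A list of weighted points of Q^2 stands for the linear combination
    of the vectors v_p, and [gram G] is the bilinear form that extends
    <v_p, v_q> = G (p - q). *)
Definition gram {R : realType} (G : rat -> rat -> R)
    (u v : seq (R * (rat * rat))) : R :=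
  \sum_(a <- u) \sum_(b <- v) a.1 * b.1 * G (a.2.1 - b.2.1) (a.2.2 - b.2.2).

Definition mass {R : realType} (u : seq (R * (rat * rat))) : R :=
  \sum_(a <- u) a.1.

Definition scalev {R : realType} (c : R) (u : seq (R * (rat * rat))) :=
  [seq (c * a.1, a.2) | a <- u].

Definition dirac_vec {R : realType} (p : rat * rat) : seq (R * (rat * rat)) :=
  [:: (1, p)].

Definition unif {R : realType} (N : nat) (f : nat -> rat * rat) :
    seq (R * (rat * rat)) :=
  [seq (N%:R^-1, f i) | i <- iota 0 N].

Definition mean {R : realType} (N : nat) (h : nat -> R) : R :=
  N%:R^-1 * \sum_(0 <= i < N) h i.

Lemma mean_le {R : realType} N (h k : nat -> R) :
  (forall i, (i < N)%N -> h i <= k i) -> mean N h <= mean N k.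
Proof.
move=> hk; rewrite /mean ler_wpM2l ?invr_ge0 ?ler0n//.
by rewrite !big_mkord; apply: ler_sum => i _; exact: hk.
Qed.

Lemma eq_mean {R : realType} N (h k : nat -> R) :
  (forall i, (i < N)%N -> h i = k i) -> mean N h = mean N k.
Proof.
move=> hk; rewrite /mean; congr (_ * _).
by rewrite !big_mkord; apply: eq_bigr => i _; exact: hk.
Qed.

Lemma mean_cst {R : realType} N (c : R) : (0 < N)%N -> mean N (fun=> c) = c.
Proof.
move=> N0; rewrite /mean sumr_const_nat subn0 -[c *+ N]mulr_natl mulrA mulVf ?mul1r//.
by rewrite pnatr_eq0 -lt0n.
Qed.

Lemma meanD {R : realType} N (h k : nat -> R) :
  mean N (fun i => h i + k i) = mean N h + mean N k.
Proof. by rewrite /mean big_split mulrDr. Qed.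

Lemma mean_indic_le {R : realType} N j : mean N (fun i => (i == j)%:R : R) <= N%:R^-1.
Proof.
rewrite /mean -[leRHS]mulr1 ler_wpM2l ?invr_ge0 ?ler0n//.
rewrite big_mkord; have [jN|jN] := ltnP j N.
  rewrite (bigD1 (Ordinal jN))//= eqxx big1 ?addr0// => i.
  by rewrite -val_eqE /= => /negbTE->.
rewrite big1 ?ler01// => i _; case: eqP => // ij.
by move: (ltn_ord i); rewrite ij ltnNge jN.
Qed.

Lemma gram_catl {R : realType} (G : rat -> rat -> R) u v w :
  gram G (u ++ v) w = gram G u w + gram G v w.
Proof. by rewrite /gram big_cat. Qed.

Lemma gram_scalel {R : realType} (G : rat -> rat -> R) c u v :
  gram G (scalev c u) v = c * gram G u v.
Proof.
rewrite /gram /scalev big_map big_distrr /=; apply: eq_bigr => a _.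
by rewrite big_distrr; apply: eq_bigr => b _ /=; rewrite !mulrA.
Qed.

Lemma gram_unif {R : realType} (G : rat -> rat -> R) N f h :
  gram G (unif N f) (unif N h) =
  mean N (fun j => mean N (fun i => G ((f i).1 - (h j).1) ((f i).2 - (h j).2))).
Proof.
rewrite /gram /unif /mean big_map exchange_big big_map /index_iota subn0 big_distrr /=.
apply: eq_bigr => j _; rewrite !big_distrr/=.
by apply: eq_bigr => i _; rewrite mulrA.
Qed.

Lemma gram_unif_dirac {R : realType} (G : rat -> rat -> R) N f p :
  gram G (unif N f) (dirac_vec p) = mean N (fun i => G ((f i).1 - p.1) ((f i).2 - p.2)).
Proof.
rewrite /gram /unif /mean big_map /index_iota subn0 big_distrr /=.
by apply: eq_bigr => j _; rewrite big_seq1 /= mulr1.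
Qed.

Lemma gram_dirac {R : realType} (G : rat -> rat -> R) p :
  gram G (dirac_vec p) (dirac_vec p) = G 0 0.
Proof. by rewrite /gram !big_seq1 /= !mul1r !subrr. Qed.

Lemma mass_unif {R : realType} N f : (0 < N)%N -> mass (unif N f) = 1 :> R.
Proof.
move=> N0; rewrite /mass /unif big_map /= big_const_seq count_predT size_iota.
by rewrite iter_addr_0 -[_ *+ _]mulr_natl divff // pnatr_eq0 -lt0n.
Qed.

Lemma gramC {R : realType} (G : rat -> rat -> R) u v :
  (forall x y, G (- x) (- y) = G x y) -> gram G u v = gram G v u.
Proof.
move=> Gev; rewrite /gram exchange_big; apply: eq_bigr => a _.
by apply: eq_bigr => b _; rewrite -Gev !opprB [a.1 * _]mulrC.
Qed.

(** Positivity is only assumed on the diagonal; the degenerate case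
    <v, v> = 0 is settled by moving far in the direction of v. *)
Lemma gram_cauchy_schwarz {R : realType} (G : rat -> rat -> R) u v :
  (forall x y, G (- x) (- y) = G x y) -> (forall w, 0 <= gram G w w) ->
  gram G u v ^+ 2 <= gram G u u * gram G v v.
Proof.
move=> Gev Gpos.
have comb c d : 0 <= c ^+ 2 * gram G u u + 2 * c * d * gram G u v + d ^+ 2 * gram G v v.
  have := Gpos (scalev c u ++ scalev d v).
  rewrite gram_catl !gram_scalel ![gram G _ (_ ++ _)]gramC// !gram_catl !gram_scalel.
  rewrite [gram G v u]gramC//; set a := gram G u u; set b := gram G u v; set e := gram G v v.
  by move=> H; apply: le_trans H _; rewrite le_eqVlt; apply/orP; left; apply/eqP; ring.
move: (Gpos u) (Gpos v) comb.
move: (gram G u u) (gram G v v) (gram G u v) => a e b a0 e0 comb.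
have [e_gt0|] := ltP 0 e; last first.
  move=> e_le0; have {e0 e_le0} e0 : e = 0 by apply/eqP; rewrite eq_le e_le0.
  rewrite e0 mulr0; have [->|b0] := eqVneq b 0; first by rewrite expr0n.
  have := comb 1 (- (a + 1) / (2 * b)).
  rewrite e0 mulr0 addr0 expr1n mul1r mulr1.
  rewrite (_ : 2 * _ * b = - (a + 1)); last by field.
  lra.
have := comb e (- b); rewrite sqrrN.
rewrite (_ : _ + _ = e * (a * e - b ^+ 2)); last by ring.
by rewrite pmulr_rge0// subr_ge0.
Qed.

(** A three-term arithmetic progression of powers of 2 would make 2 d + 1
    divide a power of 2 for some d > 0.  The absence of such
    progressions keeps the rows of the Gram matrices of [ker_11_gt0] free of
    repetitions. *)
Lemma pow2_midpoint i j k : (2 ^ i + 2 ^ k = 2 * 2 ^ j)%N -> i = k.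
Proof.
wlog ik : i k / (i <= k)%N.
  by move=> H; have [/H//|/ltnW/H{}H E] := leqP i k; apply/esym/H; rewrite addnC.
rewrite leq_eqVlt in ik; case/orP: ik => [/eqP//|ik].
rewrite -(subnKC ik) addSn expnS expnD.
have -> : (2 ^ i + 2 * (2 ^ i * 2 ^ (k - i.+1)) = 2 ^ i * (2 * 2 ^ (k - i.+1) + 1))%N by lia.
move=> E; exfalso.
have : (2 * 2 ^ (k - i.+1) + 1 %| 2 ^ j.+1)%N by rewrite expnS -E dvdn_mull.
case/(dvdn_pfactor _ _ (isT : prime 2)) => [[|m] _].
  by have := expn_gt0 2 (k - i.+1); rewrite expn0; lia.
by rewrite expnS; lia.
Qed.

(** * Kernels invariant under hyperbolic dilations *)

(** [ker_mass] says at once that G is positive definite and that its spectral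
    measure gives mass at least d to the trivial character. *)
Record dilation_kernel {R : realType} (d : R) (G : rat -> rat -> R) : Prop := {
  ker_ge0 : forall x y, 0 <= G x y;
  ker_le_origin : forall x y, G x y <= G 0 0;
  ker_origin_le1 : G 0 0 <= 1;
  ker_even : forall x y, G (- x) (- y) = G x y;
  ker_dilate : forall (c : nat) x y, (0 < c)%N -> G (c%:R * x) (y / c%:R) = G x y;
  ker_mass : forall u, d * mass u ^+ 2 <= gram G u u }.

Lemma rat_gt0_frac (x : rat) : 0 < x ->
  exists a b : nat, [/\ (0 < a)%N, (0 < b)%N & x = a%:R / b%:R].
Proof.
move=> x0; exists `|numq x|%N, `|denq x|%N.
have n0 : 0 < numq x by rewrite numq_gt0.
split; rewrite ?absz_gt0 ?denq_neq0 ?gt_eqF//.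
by rewrite -[LHS]divq_num_den !pmulrn !gez0_abs ?denq_ge0// ltW.
Qed.

(** The dilations act transitively on each branch of a hyperbola x y = t of
    rational points, and evenness exchanges the two branches. *)
Lemma ker_hyperbola {R : realType} (d : R) G x y : dilation_kernel d G ->
  x != 0 -> G x y = G 1 (x * y).
Proof.
move=> K; wlog x0 : x y / 0 < x => [H xn|_].
  have [x0|x0] := ltP 0 x; first exact: H.
  have {x0}x0 : 0 < - x by rewrite oppr_gt0 lt_neqAle xn.
  by rewrite -(ker_even _ _ K) H ?mulrNN// gt_eqF.
have [a [b [a0 b0 ->]]] := rat_gt0_frac _ x0.
have an : a%:R != 0 :> rat by rewrite pnatr_eq0 -lt0n.
have bn : b%:R != 0 :> rat by rewrite pnatr_eq0 -lt0n.
rewrite -(ker_dilate _ _ K b _ _ b0) -[RHS](ker_dilate _ _ K a _ _ a0).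
by congr (G _ _); field; rewrite ?an ?bn.
Qed.

Lemma ker_axis {R : realType} (d : R) G y : dilation_kernel d G ->
  y != 0 -> G 0 y = G 0 1.
Proof.
move=> K; wlog y0 : y / 0 < y => [H yn|_].
  have [y0|y0] := ltP 0 y; first exact: H.
  have {y0}y0 : 0 < - y by rewrite oppr_gt0 lt_neqAle yn.
  by rewrite -(ker_even _ _ K) oppr0 H// gt_eqF.
have [a [b [a0 b0 ->]]] := rat_gt0_frac _ y0.
have an : a%:R != 0 :> rat by rewrite pnatr_eq0 -lt0n.
have bn : b%:R != 0 :> rat by rewrite pnatr_eq0 -lt0n.
rewrite -(ker_dilate _ _ K a _ _ a0) -[RHS](ker_dilate _ _ K b _ _ b0).
by congr (G _ _); field; rewrite ?an ?bn.
Qed.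

Lemma ker_gram_ge0 {R : realType} (d : R) G u : 0 <= d -> dilation_kernel d G ->
  0 <= gram G u u.
Proof.
by move=> d0 K; apply: le_trans (ker_mass _ _ K u); rewrite mulr_ge0// sqr_ge0.
Qed.

Lemma gram_diff {R : realType} (G : rat -> rat -> R) u v :
  (forall x y, G (- x) (- y) = G x y) ->
  gram G (u ++ scalev (-1) v) (u ++ scalev (-1) v) =
  gram G u u - 2 * gram G u v + gram G v v.
Proof.
move=> Gev; rewrite gram_catl gram_scalel ![gram G _ (_ ++ _)]gramC//.
rewrite !gram_catl !gram_scalel [gram G v u]gramC//; ring.
Qed.

(** Bessel's inequality in the form of a single application of Cauchy-Schwarz:
    pair v_(1,0) with the difference of the means of v_(0,-t_i) and
    v_(0,-t'_i).  By [ker_axis] distinct vectors of these families have the same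
    inner product, so the common component cancels in the difference, whose
    squared norm is then at most 2 / N. *)
Lemma ker_bessel {R : realType} (d : R) G N (t t' : nat -> rat) :
  0 <= d -> dilation_kernel d G -> (0 < N)%N -> injective t -> injective t' ->
  (mean N (fun i => G 1 (t i)) - mean N (fun i => G 1 (t' i))) ^+ 2 <= 2 / N%:R.
Proof.
move=> d0 K N0 tI t'I.
pose v (t : nat -> rat) := unif (R := R) N (fun i => (0, - t i)).
have c0 := ker_ge0 _ _ K 0 1.
have diag s : injective s -> gram G (v s) (v s) <= G 0 1 + N%:R^-1.
  move=> sI; rewrite gram_unif.
  rewrite -[leRHS](mean_cst N)//; apply: mean_le => j jN /=.
  apply: le_trans (_ : mean N (fun i => G 0 1 + (i == j)%:R) <= _); last first.
    by rewrite meanD mean_cst// lerD2l mean_indic_le.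
  apply: mean_le => i iN; rewrite subrr opprK.
  have [->|ij] := eqVneq i j.
    by rewrite addNr; apply: le_trans (ker_origin_le1 _ _ K) _; rewrite lerDr.
  rewrite (ker_axis d)// ?addr0// addrC subr_eq0; apply: contra_neq ij.
  by move=> /esym/sI.
(* Coincidences t_i = t'_j only increase this inner product. *)
have cross : G 0 1 <= gram G (v t) (v t').
  rewrite gram_unif -[leLHS](mean_cst N)//; apply: mean_le => j jN.
  rewrite -[leLHS](mean_cst N)//; apply: mean_le => i iN /=.
  rewrite subrr opprK; have [->|nz] := eqVneq (- t i + t' j) 0.
    exact: ker_le_origin K _ _.
  by rewrite (ker_axis d).
have := gram_cauchy_schwarz G (v t ++ scalev (-1) (v t')) (dirac_vec (1, 0))
   (ker_even _ _ K) (fun w => ker_gram_ge0 _ _ w d0 K).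
rewrite gram_diff; last exact: ker_even K.
rewrite gram_catl gram_scalel mulN1r !gram_unif_dirac gram_dirac.
have e s : mean N (fun i => G ((0 : rat, - s i).1 - 1) ((0 : rat, - s i).2 - 0)) =
   mean N (fun i => G 1 (s i)).
  by apply: eq_mean => i _ /=; rewrite sub0r subr0 (ker_even _ _ K).
rewrite !e => H; apply: le_trans H _.
have := diag _ tI; have := diag _ t'I; have := ker_origin_le1 _ _ K.
have := ker_ge0 _ _ K 0 0.
have := ker_gram_ge0 _ _ (v t ++ scalev (-1) (v t')) d0 K.
rewrite gram_diff; last exact: ker_even K.
nra.
Qed.

Lemma pow2_neq_mul3 m j : (2 ^ m != 3 * 2 ^ j)%N.
Proof.
apply/eqP => E; have : (3 %| 2 ^ m)%N by rewrite E dvdn_mulr.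
by case/(dvdn_pfactor _ _ (isT : prime 2)) => [[|k] _] //; rewrite expnS; lia.
Qed.

Lemma add_inv_inj (x y : rat) : 0 < x -> 0 < y ->
  x + x^-1 = y + y^-1 -> x = y \/ x * y = 1.
Proof.
move=> x0 y0 e; have : (x - y) * (x * y - 1) = 0.
  rewrite (_ : _ * _ = (x * y) * ((x + x^-1) - (y + y^-1))); last first.
    by field; rewrite !gt_eqF.
  by rewrite e subrr mulr0.
move/eqP; rewrite mulf_eq0 !subr_eq0 => /orP[] /eqP; by [left|right].
Qed.

(** The points p_i = (c_i, 1 / c_i) lie on the hyperbola x y = 1, and the points
    q_j = (x_j, x_j) are chosen so that, in each block of the Gram matrix of all
    p_i and q_j, the products of coordinates of the differences are distinct
    along each row: [ker_bessel] then gives every row the average L. *)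
Theorem ker_11_gt0 {R : realType} (d : R) G :
  0 < d -> dilation_kernel d G -> 0 < G 1 1.
Proof.
move=> d0 K; rewrite ltNge; apply/negP => G11.
have d1 : d <= 1.
  have := ker_mass _ _ K (dirac_vec (0, 0)); rewrite gram_dirac /mass big_seq1 expr1n mulr1.
  by move/le_trans; apply; exact: ker_origin_le1 K.
(* e bounds all errors; the divisor 50 makes (d / 2)^2 <= 6 e absurd. *)
pose e := d ^+ 2 / 50; have e0 : 0 < e by rewrite /e divr_gt0 ?exprn_gt0.
have e1 : e <= d / 50 by rewrite /e; nra.
have [N N0 Ne] : exists2 N : nat, (0 < N)%N & 2 / N%:R <= e ^+ 2.
  exists (Num.truncn (2 / e ^+ 2)).+1 => //.
  have h : 2 / e ^+ 2 < (Num.truncn (2 / e ^+ 2)).+1%:R by rewrite truncnS_gt.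
  rewrite ler_pdivrMr ?ltr0n// mulrC -ler_pdivrMr ?exprn_gt0//; exact: ltW.
have N1e : N%:R^-1 <= e.
  have : 0 <= N%:R^-1 :> R by rewrite invr_ge0 ler0n.
  nra.
(* The factor 3 keeps c_i apart from x_j. *)
pose c i : rat := 2 ^+ (2 ^ i); pose x j : rat := 3 * 2 ^+ j.
have c0 i : 0 < c i by rewrite exprn_gt0.
have x0 i : 0 < x i by rewrite mulr_gt0 ?exprn_gt0.
have cx i j : c i != x j.
  apply/eqP => /eqP; rewrite /c /x -!natrX -natrM eqr_nat; exact/negP/pow2_neq_mul3.
have cM i j k : c i * c k = c j ^+ 2 -> i = k.
  rewrite /c -exprD -exprM -!natrX => /eqP; rewrite eqr_nat eqn_exp2l// => /eqP E.
  by apply: (@pow2_midpoint i j k); rewrite E mulnC.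
have cI : injective c.
  by move=> i k ik; apply: (cM i i); rewrite -ik expr2.
have xM i j k : x i + x k = 2 * x j -> i = k.
  move=> E; apply: (@pow2_midpoint i j k); apply/eqP.
  rewrite -(eqr_nat rat) natrD natrM !natrX; apply/eqP; move: E; rewrite /x; lra.
have xI : injective x.
  by move=> i k ik; apply: (xM i i); rewrite -ik; ring.
pose g := G 1.
pose L := mean N (fun j => g (x j * x j)).
have near t : injective t -> `|mean N (fun i => g (t i)) - L| <= e.
  move=> tI; have qI : injective (fun j => x j * x j).
    move=> i k /eqP; rewrite -!expr2 eqrXn2 ?ltW// => /eqP; exact: xI.
  have sq := le_trans (ker_bessel _ _ _ _ _ (ltW d0) K N0 tI qI) Ne.
  by rewrite -(@ler_pXn2r _ 2)// ?nnegrE ?(ltW e0)// real_normK ?num_real.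
pose P := unif (R := R) N (fun i => (c i, (c i)^-1)).
pose Q := unif (R := R) N (fun j => (x j, x j)).
(* A diagonal entry of the Gram matrix is not a value of g off the axes; it
   costs the error 1 / N. *)
have row t j h : injective t -> (forall i, i != j -> h i = g (t i)) ->
    (forall i, 0 <= h i <= 1) -> mean N h <= L + e + N%:R^-1.
  move=> tI ht hb.
  apply: le_trans (_ : mean N (fun i => g (t i) + (i == j)%:R) <= _).
    apply: mean_le => i _; have [->|ij] := eqVneq i j.
      rewrite (le_trans (andP (hb j)).2)// lerDr; exact: ker_ge0 K _ _.
    by rewrite ht// addr0.
  have := near t tI; rewrite meanD ler_norml => /andP[_ h1].
  by have := mean_indic_le (R := R) N j; lra.
have Gb y z : 0 <= G y z <= 1.
  rewrite (ker_ge0 _ _ K) (le_trans (ker_le_origin _ _ K _ _))//.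
  exact: ker_origin_le1 K.
have PP : gram G P P <= L + e + N%:R^-1.
  rewrite gram_unif -[leRHS](mean_cst N)//; apply: mean_le => j _ /=.
  apply: (row (fun i => (c i - c j) * ((c i)^-1 - (c j)^-1)) j) => //.
    move=> i k E.
    have r (l : nat) : (c l - c j) * ((c l)^-1 - (c j)^-1) = 2 - (c l / c j + (c l / c j)^-1).
      by field; rewrite !gt_eqF.
    have {}E : c i / c j + (c i / c j)^-1 = c k / c j + (c k / c j)^-1.
      by move: E; rewrite !r; lra.
    case: (add_inv_inj _ _ _ _ E); rewrite ?divr_gt0//.
      by move/(mulIf (invr_neq0 (lt0r_neq0 (c0 j))))/cI.
    move=> E'; apply: (cM i j k).
    by rewrite -[RHS]mul1r -E'; field; rewrite gt_eqF.
  move=> i ij; rewrite (ker_hyperbola d)// subr_eq0; apply: contra_neq ij; exact: cI.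
have QQ : gram G Q Q <= L + e + N%:R^-1.
  rewrite gram_unif -[leRHS](mean_cst N)//; apply: mean_le => j _ /=.
  apply: (row (fun i => (x i - x j) * (x i - x j)) j) => //.
    move=> i k /eqP; rewrite -!expr2 eqf_sqr => /orP[] /eqP E.
      by apply: xI; move: E; lra.
    by apply: (xM i j k); move: E; lra.
  move=> i ij; rewrite (ker_hyperbola d)// subr_eq0; apply: contra_neq ij; exact: xI.
have PQ : L - e <= gram G P Q.
  rewrite gram_unif -[leLHS](mean_cst N)//; apply: mean_le => j _ /=.
  have tI : injective (fun i => (c i - x j) * ((c i)^-1 - x j)).
    move=> i k E.
    have r (l : nat) : (c l - x j) * ((c l)^-1 - x j) =
        1 + x j ^+ 2 - x j * (c l + (c l)^-1).
      by field; rewrite !gt_eqF.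
    have {}E : c i + (c i)^-1 = c k + (c k)^-1.
      apply: (mulfI (lt0r_neq0 (x0 j))); move: E; rewrite !r; lra.
    case: (add_inv_inj _ _ _ _ E) => //; first exact: cI.
    have c1 l : 1 < c l by rewrite exprn_egt1// expn_eq0.
    have : 1 < c i * c k by rewrite -[ltLHS]mul1r ltr_pM// ltW.
    by move=> + cc; rewrite cc ltxx.
  have := near _ tI; rewrite ler_norml => /andP[lo _].
  rewrite (@eq_mean _ N _ (fun i => g ((c i - x j) * ((c i)^-1 - x j)))); first by lra.
  by move=> i _; rewrite (ker_hyperbola d)// subr_eq0.
have Ld : d <= L + e + N%:R^-1.
  have := ker_mass _ _ K Q; rewrite mass_unif// expr1n mulr1; lra.
have := gram_cauchy_schwarz G (P ++ scalev (-1) Q) (dirac_vec (0, 0))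
   (ker_even _ _ K) (fun w => ker_gram_ge0 _ _ w (ltW d0) K).
rewrite gram_diff; last exact: ker_even K.
rewrite gram_catl gram_scalel mulN1r !gram_unif_dirac gram_dirac.
rewrite (@eq_mean _ N _ (fun=> g 1)); last first.
  move=> i _ /=; rewrite !subr0 (ker_hyperbola d) ?mulfV//; exact: lt0r_neq0.
rewrite mean_cst//.
rewrite (@eq_mean _ N _ (fun j => g (x j * x j))); last first.
  move=> i _ /=; rewrite !subr0 (ker_hyperbola d)//; exact: lt0r_neq0.
rewrite -/L; have := Gb 0 0 => /andP[G0 G01].
move=> H.
have {}H : (L - g 1) ^+ 2 <= 6 * e.
  have := ker_gram_ge0 _ _ (P ++ scalev (-1) Q) (ltW d0) K.
  rewrite gram_diff; last exact: ker_even K.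
  by move: H; nra.
have g1 : g 1 = 0.
  by apply/eqP; rewrite eq_le G11; case/andP: (Gb 1 1).
move: H; rewrite g1 subr0 => H.
have : d / 2 <= L by lra.
move: H; rewrite /e; nra.
Qed.

(** * Correlations of finite sets *)

Definition corr {R : realType} {T : zmodType} (S : seq T) (d : T) : R :=
  \sum_(s <- S) (s + d \in S)%:R.

Lemma corr_ge0 {R : realType} {T : zmodType} (S : seq T) d : 0 <= corr S d :> R.
Proof. exact: sumr_ge0. Qed.

Lemma corr0 {R : realType} {T : zmodType} (S : seq T) : corr S 0 = (size S)%:R :> R.
Proof.
rewrite /corr big_seq (eq_bigr (fun=> 1)); last by move=> s sS; rewrite addr0 sS.
by rewrite -big_seq big_const_seq count_predT iter_addr_0.
Qed.

Lemma corr_le {R : realType} {T : zmodType} (S : seq T) d : corr S d <= corr S 0 :> R.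
Proof.
rewrite /corr !big_seq; apply: ler_sum => s sS.
by rewrite addr0 sS ler_nat leq_b1.
Qed.

Lemma corr_neq0 {R : realType} {T : zmodType} (S : seq T) d :
  corr S d != 0 :> R -> exists2 s, s \in S & s + d \in S.
Proof.
move=> nz; apply/hasP; apply: contraNT nz => /hasPn h.
by rewrite /corr big_seq big1// => s /h /negbTE->.
Qed.

(** The substitution v = s - x: the correlation is the inner product of two
    translates of the indicator of S, restricted to any V large enough. *)
Lemma corr_shift {R : realType} {T : zmodType} (S V : seq T) x y :
  uniq S -> uniq V -> (forall s, s \in S -> s - x \in V) ->
  \sum_(v <- V) (v + x \in S)%:R * (v + y \in S)%:R = corr S (y - x) :> R.
Proof.
move=> uS uV SV; rewrite (bigID (fun v => v + x \in S))/= [X in _ + X]big1 ?addr0; last first.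
  by move=> v /negbTE->; rewrite mul0r.
rewrite -big_filter.
have pe : perm_eq [seq v <- V | v + x \in S] [seq s - x | s <- S].
  apply: uniq_perm; first exact: filter_uniq.
    by rewrite map_inj_uniq// => a b /addIr.
  move=> v; rewrite mem_filter; apply/andP/mapP.
    by move=> [vS _]; exists (v + x) => //; rewrite addrK.
  by move=> [s sS ->]; rewrite subrK sS SV.
rewrite (perm_big _ pe) big_map /corr big_seq [RHS]big_seq.
apply: eq_bigr => s sS; rewrite subrK sS mul1r.
by rewrite -addrA [- x + y]addrC.
Qed.

Lemma corrN {R : realType} {T : zmodType} (S : seq T) d :
  uniq S -> corr S (- d) = corr S d :> R.
Proof.
move=> uS; pose V := undup (S ++ [seq s - d | s <- S]).
have SV s : s \in S -> s - 0 \in V by move=> sS; rewrite subr0 mem_undup mem_cat sS.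
have SdV s : s \in S -> s - d \in V.
  by move=> sS; rewrite mem_undup mem_cat; apply/orP; right; exact: map_f.
rewrite -[- d]sub0r -[in RHS](subr0 d).
rewrite -(corr_shift S V d 0)// ?undup_uniq//.
rewrite -(corr_shift S V 0 d)// ?undup_uniq//.
by apply: eq_bigr => v _; rewrite mulrC.
Qed.

Lemma corr_mass {R : realType} {T : zmodType} (S V : seq T) x :
  uniq S -> uniq V -> (forall s, s \in S -> s - x \in V) ->
  \sum_(v <- V) (v + x \in S)%:R = (size S)%:R :> R.
Proof.
move=> uS uV SV; rewrite -corr0 -(subrr x) -(corr_shift S V)//.
by apply: eq_bigr => v _; rewrite -natrM mulnb andbb.
Qed.

(** Cauchy-Schwarz against the constant function; the induction step is
    the nonnegativity of the sum of the squares (h v - h a)^2. *)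
Lemma sqr_sum_le {R : realType} {T : Type} (V : seq T) (h : T -> R) :
  (\sum_(v <- V) h v) ^+ 2 <= (size V)%:R * \sum_(v <- V) h v ^+ 2.
Proof.
elim: V => [|a V IH]; first by rewrite !big_nil expr0n mulr0.
have : 0 <= \sum_(v <- V) (h v - h a) ^+ 2 by apply: sumr_ge0 => v _; exact: sqr_ge0.
have -> : \sum_(v <- V) (h v - h a) ^+ 2 = \sum_(v <- V) h v ^+ 2 -
    2 * h a * \sum_(v <- V) h v + (size V)%:R * h a ^+ 2.
  elim: V {IH} => [|b V IH]; first by rewrite !big_nil /=; ring.
  by rewrite !big_cons IH /= -natr1; ring.
by rewrite !big_cons /= -natr1; nra.
Qed.

(** The form on the right is the sum over V of the squares of a combination of
    translates of the indicator of S, and the square root of the left side is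
    the sum of this combination over V. *)
Lemma corr_psd {R : realType} {T : zmodType} (S V : seq T) (u : seq (R * T)) :
  uniq S -> uniq V -> (forall a s, a \in u -> s \in S -> s - a.2 \in V) ->
  (size S)%:R ^+ 2 * (\sum_(a <- u) a.1) ^+ 2 <=
  (size V)%:R * \sum_(a <- u) \sum_(b <- u) a.1 * b.1 * corr S (a.2 - b.2).
Proof.
move=> uS uV SV.
pose h v : R := \sum_(a <- u) a.1 * (v + a.2 \in S)%:R.
have -> : \sum_(a <- u) \sum_(b <- u) a.1 * b.1 * corr S (a.2 - b.2) =
    \sum_(v <- V) h v ^+ 2.
  rewrite (eq_bigr (fun v => \sum_(a <- u) \sum_(b <- u)
    a.1 * b.1 * ((v + b.2 \in S)%:R * (v + a.2 \in S)%:R))); last first.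
    move=> v _; rewrite expr2 {1}/h big_distrl /=; apply: eq_bigr => a _.
    by rewrite /h big_distrr /=; apply: eq_bigr => b _; ring.
  rewrite [RHS]exchange_big /=; apply: eq_bigr => a _.
  rewrite [RHS]exchange_big /= big_seq [RHS]big_seq; apply: eq_bigr => b bu.
  rewrite -big_distrr /= (corr_shift S V)// => s sS; exact: SV.
have -> : (size S)%:R ^+ 2 * (\sum_(a <- u) a.1) ^+ 2 = (\sum_(v <- V) h v) ^+ 2.
  rewrite -exprMn; congr (_ ^+ 2); rewrite /h exchange_big big_distrr /=.
  rewrite big_seq [RHS]big_seq; apply: eq_bigr => a au.
  by rewrite -big_distrr /= corr_mass 1?mulrC// => s sS; exact: SV.
exact: sqr_sum_le.
Qed.

(** * Correlations of sets of positive Banach density *)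

Lemma int_window_finite a N : finite_set (int_window a N).
Proof.
apply: (sub_finite_set _ (finite_image (fun i : nat => a + i%:Z) (finite_II N))).
move=> x /= /andP[ax xa]; exists `|x - a|%N; lia.
Qed.

(** The limsup exceeds alpha / 2, so windows of this density occur beyond every
    length M. *)
Lemma density_window {R : realType} (E : set int) (alpha : R) (M : nat) :
  0 < alpha -> upper_banach_density R E = alpha%:E ->
  exists (N : nat) (a : int) (S : seq int),
    [/\ (M <= N)%N, (0 < N)%N, uniq S,
        (forall s, s \in S -> E s /\ a <= s <= a + (N%:Z - 1)) &
        alpha / 2 * N%:R <= (size S)%:R].
Proof.
move=> a0 dE.
have : ((alpha / 2)%:E < upper_banach_density R E)%E by rewrite dE lte_fin; lra.
rewrite /upper_banach_density /limn_esup limf_esupE => lt.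
have lt2 : ((alpha / 2)%:E < ereal_sup ((fun N : nat =>
    ereal_sup [set ((#|` fset_set (E `&` int_window a N) |)%:R / N%:R : R)%:E
              | a in [set: int]]) @` [set N | (M.+1 <= N)%N]))%E.
  apply: lt_le_trans lt _; apply: ereal_inf_lbound => /=.
  by exists [set N | (M.+1 <= N)%N] => //=; exists M.+1.
have [_ [N /= MN <-] /ereal_sup_gt[_ [a _ <-]]] := ereal_sup_gt lt2.
rewrite lte_fin => aN; exists N, a, (fset_set (E `&` int_window a N)).
have N0 : (0 < N)%N by apply: leq_trans MN.
have fin : finite_set (E `&` int_window a N).
  exact: sub_finite_set (@subIsetr _ _ _) (int_window_finite a N).
split => //; first exact: ltnW; first exact: fset_uniq.
- by move=> s; rewrite in_fset_set// inE => -[].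
- by rewrite -ler_pdivlMr ?ltr0n// ltW.
Qed.

Definition int_range (a : int) (N : nat) : seq int := [seq a + i%:Z | i <- iota 0 N].

Lemma mem_int_range a N x : (x \in int_range a N) = (a <= x <= a + (N%:Z - 1)).
Proof.
apply/mapP/idP => [[i + ->]|h]; first by rewrite mem_iota; lia.
exists `|x - a|%N; last by lia.
by rewrite mem_iota; lia.
Qed.

Lemma int_range_uniq a N : uniq (int_range a N).
Proof. by rewrite map_inj_uniq ?iota_uniq// => i j /addrI []. Qed.

Definition grid (X Y : seq int) : seq (rat * rat) :=
  [seq (x%:~R, y%:~R) | x <- X, y <- Y].

Lemma grid_uniq X Y : uniq X -> uniq Y -> uniq (grid X Y).
Proof.
move=> uX uY; apply: allpairs_uniq => //.
by move=> [a b] [c d] _ _ /= [] /intr_inj -> /intr_inj ->.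
Qed.

Lemma mem_grid X Y (x y : int) : ((x%:~R, y%:~R) \in grid X Y) = (x \in X) && (y \in Y).
Proof.
apply/allpairsP/andP => [[[a b] /= [aX bY [/intr_inj-> /intr_inj->]]]|[xX yY]] //.
by exists (x, y).
Qed.

(** F is the normalized correlation of a grid S of points of E1 x E2 in two
    windows of lengths N1, N2 >= B.  All translates of S by shifts bounded by B
    lie in one grid of 9 N1 N2 points; as S has at least
    (alpha / 2) (beta / 2) N1 N2 points, [corr_psd] gives
    the mass (alpha beta / 4)^2 / 9. *)
Lemma window_kernel {R : realType} (E1 E2 : set int) (alpha beta : R) (B : nat) :
  0 < alpha -> 0 < beta ->
  upper_banach_density R E1 = alpha%:E -> upper_banach_density R E2 = beta%:E ->
  exists F : rat -> rat -> R,
    [/\ forall x y, 0 <= F x y <= F 0 0, F 0 0 <= 1,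
        forall x y, F (- x) (- y) = F x y,
        forall x y, F x y != 0 -> exists m n : int,
          [/\ x = m%:~R, y = n%:~R, diff_set E1 m & diff_set E2 n] &
        forall u, (forall a, a \in u -> exists m n : int,
            [/\ a.2 = (m%:~R, n%:~R), `|m| <= B%:Z & `|n| <= B%:Z]) ->
          (alpha * beta) ^+ 2 / 144 * mass u ^+ 2 <= gram F u u].
Proof.
move=> a0 b0 dE1 dE2.
have [N1 [a1 [S1 [BN1 N10 uS1 S1E S1d]]]] := density_window _ _ B a0 dE1.
have [N2 [a2 [S2 [BN2 N20 uS2 S2E S2d]]]] := density_window _ _ B b0 dE2.
pose S := grid S1 S2.
have uS : uniq S by exact: grid_uniq.
have sS : size S = (size S1 * size S2)%N by rewrite size_allpairs.
have le N a (T : seq int) : uniq T -> (forall s, s \in T -> a <= s <= a + (N%:Z - 1)) ->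
    (size T <= N)%N.
  move=> uT Ta; rewrite -(size_iota 0 N) -(size_map (fun i : nat => a + i%:Z)).
  by apply: uniq_leq_size => // s /Ta; rewrite -/(int_range a N) mem_int_range.
have S1N := le _ _ _ uS1 (fun s sS => (S1E s sS).2).
have S2N := le _ _ _ uS2 (fun s sS => (S2E s sS).2).
pose M : R := N1%:R * N2%:R.
have M0 : 0 < M by rewrite mulr_gt0 ?ltr0n.
exists (fun x y => corr S (x, y) / M); split.
- move=> x y; rewrite divr_ge0 ?corr_ge0 ?(ltW M0)//=.
  by rewrite ler_pM2r ?invr_gt0// corr_le.
- by rewrite ler_pdivrMr// mul1r corr0 sS natrM ler_pM ?ler_nat.
- by move=> x y; congr (_ / _); rewrite -(corrN S (x, y)).
- move=> x y; rewrite mulf_eq0 => /norP[+ _] => /corr_neq0[s /allpairsP[[p q] /= [pS qS ->]]].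
  move=> /allpairsP[[p' q'] /= [p'S q'S [e1 e2]]].
  exists (p' - p), (q' - q); split; rewrite ?rmorphB /=.
  + by rewrite -e1 addrC addKr.
  + by rewrite -e2 addrC addKr.
  + by exists p'; [exact: (S1E _ p'S).1|exists p => //; exact: (S1E _ pS).1].
  + by exists q'; [exact: (S2E _ q'S).1|exists q => //; exact: (S2E _ qS).1].
- move=> u uB.
  pose V := grid (int_range (a1 - N1%:Z) (3 * N1)) (int_range (a2 - N2%:Z) (3 * N2)).
  have uV : uniq V by apply: grid_uniq; exact: int_range_uniq.
  have SV a s : a \in u -> s \in S -> s - a.2 \in V.
    move=> /uB[m [n [-> mB nB]]] /allpairsP[[p q] /= [/S1E[_ p1] /S2E[_ q2] ->]].
    rewrite (_ : _ - _ = ((p - m)%:~R, (q - n)%:~R)); last by rewrite !rmorphB.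
    by rewrite mem_grid !mem_int_range; apply/andP; split; lia.
  have := corr_psd (R := R) S V u uS uV SV.
  rewrite sS size_allpairs !size_map !size_iota.
  set Z := \sum_(a <- u) \sum_(b <- u) _ => H.
  have -> : gram (fun x y => corr S (x, y) / M) u u = Z / M.
    rewrite /gram /Z big_distrl /=; apply: eq_bigr => a _.
    by rewrite big_distrl /=; apply: eq_bigr => b _; rewrite mulrA.
  rewrite ler_pdivlMr//.
  have {}H : (size S1 * size S2)%:R ^+ 2 * mass u ^+ 2 <= 9 * M * Z.
    apply: le_trans H _; rewrite (_ : (3 * N1 * (3 * N2))%:R = 9 * M)// /M.
    by rewrite !natrM; ring.
  have dd : (alpha * beta) / 4 * M <= (size S1 * size S2)%:R.
    rewrite natrM (_ : _ * M = (alpha / 2 * N1%:R) * (beta / 2 * N2%:R)).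
      by apply: ler_pM => //; rewrite !mulr_ge0 ?ler0n ?invr_ge0 ?(ltW a0) ?(ltW b0).
    by rewrite /M; field.
  have dd2 : ((alpha * beta) / 4 * M) ^+ 2 <= (size S1 * size S2)%:R ^+ 2.
    rewrite ler_pXn2r ?nnegrE ?ler0n//.
    by rewrite !mulr_ge0 ?(ltW M0) ?(ltW a0) ?(ltW b0)// invr_ge0.
  have {}H : ((alpha * beta) / 4 * M) ^+ 2 * mass u ^+ 2 <= 9 * M * Z.
    by apply: le_trans H; rewrite ler_wpM2r// sqr_ge0.
  have M9 : 0 < 9 * M by rewrite mulr_gt0.
  rewrite -(ler_pM2l M9); apply: le_trans H.
  by rewrite le_eqVlt; apply/orP; left; apply/eqP; field.
Qed.

(** * Averaging over dilations *)

(** The products of the powers m^(t_m), for 1 <= m <= j and t_m < N, with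
    multiplicity: a box in the multiplicative monoid of the positive integers. *)
Fixpoint dilations (N j : nat) : seq nat :=
  if j is j'.+1 then [seq (c * j ^ t)%N | c <- dilations N j', t <- iota 0 N]
  else [:: 1%N].

Lemma dilations_gt0 N j c : c \in dilations N j -> (0 < c)%N.
Proof.
elim: j c => [|j IH] c /=; first by rewrite inE => /eqP->.
by case/allpairsP => [[d t] /= [/IH d0 _ ->]]; rewrite muln_gt0 d0 expn_gt0.
Qed.

Lemma size_dilations N j : size (dilations N j) = (N ^ j)%N.
Proof. by elim: j => //= j IH; rewrite size_allpairs IH size_iota expnSr. Qed.

Lemma sum_dilationsS {R : realType} N j (h : nat -> R) :
  \sum_(c <- dilations N j.+1) h c =
  \sum_(0 <= t < N) \sum_(c <- dilations N j) h (c * j.+1 ^ t)%N.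
Proof. by rewrite /= big_allpairs_dep exchange_big /index_iota subn0. Qed.

(** Multiplication by m shifts one coordinate of the box by 1, so the sum
    telescopes in this coordinate: the box is a Folner set up to 1 / N. *)
Lemma dilations_folner {R : realType} N j m (h : nat -> R) :
  (forall c, 0 <= h c <= 1) -> (0 < m <= j)%N ->
  N%:R * `|\sum_(c <- dilations N j) h (c * m)%N - \sum_(c <- dilations N j) h c|
  <= (N ^ j)%:R.
Proof.
elim: j h => [|j IH] h hb; first by rewrite leqn0; case: m.
rewrite !sum_dilationsS.
have [->|mj] := eqVneq m j.+1 => [_|/andP[m0 mj1]]; last first.
  rewrite -sumrB expnS natrM.
  apply: le_trans (ler_wpM2l (ler0n _ N) (ler_norm_sum _ _ _)) _.
  rewrite big_distrr /=.
  apply: le_trans (_ : \sum_(0 <= t < N) (N ^ j)%:R <= _).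
    apply: ler_sum => t _.
    apply: le_trans (IH (fun c => h (c * j.+1 ^ t)%N) _ _) => //; last first.
      by rewrite m0 /=; lia.
    rewrite ler_wpM2l// le_eqVlt; apply/orP; left; apply/eqP; congr (`|_ - _|).
    by apply: eq_bigr => c _; congr (h _); rewrite mulnAC.
  by rewrite sumr_const_nat subn0 mulr_natl.
(* m = j + 1: the sum over the exponent of j + 1 telescopes. *)
rewrite -sumrB.
rewrite (eq_bigr (fun t => \sum_(c <- dilations N j) h (c * j.+1 ^ t.+1)%N -
    \sum_(c <- dilations N j) h (c * j.+1 ^ t)%N)); last first.
  move=> t _; congr (_ - _); apply: eq_bigr => c _; congr (h _).
  by rewrite expnS; lia.
rewrite telescope_sumr// expnS natrM ler_wpM2l//.
rewrite -sumrB; apply: le_trans (ler_norm_sum _ _ _) _.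
have -> : (N ^ j)%:R = \sum_(c <- dilations N j) 1 :> R.
  by rewrite big_const_seq count_predT iter_addr_0 size_dilations.
apply: ler_sum => c _.
by have := hb (c * j.+1 ^ N)%N; have := hb (c * j.+1 ^ 0)%N; rewrite ler_norml; lra.
Qed.

(** The factorial clears the denominators of the points of the stage, even after
    division by a dilation factor c, which divides the second factor. *)
Definition stage_scale (j : nat) : nat := (j`! * \prod_(c <- dilations j.+1 j) c)%N.

Lemma stage_scale_gt0 j : (0 < stage_scale j)%N.
Proof.
rewrite muln_gt0 fact_gt0 big_seq; apply: prodn_cond_gt0 => c; exact: dilations_gt0.
Qed.

Lemma dvdn_stage_scale j c : c \in dilations j.+1 j ->
  exists P, (stage_scale j = j`! * (P * c))%N.
Proof.
move=> cD; exists (\prod_(b <- rem c (dilations j.+1 j)) b)%N.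
by rewrite /stage_scale (perm_big _ (perm_to_rem cD)) big_cons; congr (_ * _)%N; exact: mulnC.
Qed.

(** The coordinates on which positivity can be asked at stage j; every rational
    number is admissible at all late stages. *)
Definition admissible (j : nat) (x : rat) : bool :=
  (j`!%:R * x \is a Num.int) && (`|x| <= j%:R).

(** A [dilation_kernel] up to the precision of stage j. *)
Record stage_kernel {R : realType} (d : R) (j : nat) (G : rat -> rat -> R) : Prop := {
  stage_bounds : forall x y, 0 <= G x y <= G 0 0;
  stage_origin_le1 : G 0 0 <= 1;
  stage_even : forall x y, G (- x) (- y) = G x y;
  stage_dilate : forall (m : nat) x y, (0 < m <= j)%N ->
    `|G (m%:R * x) (y / m%:R) - G x y| <= j.+1%:R^-1;
  stage_mass : forall u, (forall a, a \in u -> admissible j a.2.1 && admissible j a.2.2) ->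
    d * mass u ^+ 2 <= gram G u u }.

(** The kernel is F (q c x) (n q y / c) averaged over the dilation factors c,
    where F comes from [window_kernel].  A nonzero value of F at
    (q c, n q / c) would write q^2 n as a product of two differences. *)
Lemma approx_kernel {R : realType} (E1 E2 : set int) (alpha beta : R) j (n : int) :
  0 < alpha -> 0 < beta ->
  upper_banach_density R E1 = alpha%:E -> upper_banach_density R E2 = beta%:E ->
  n != 0 ->
  ~ prod_set (diff_set E1) (diff_set E2) ((stage_scale j ^ 2)%N%:Z * n) ->
  exists2 G : rat -> rat -> R,
    stage_kernel ((alpha * beta) ^+ 2 / 144) j G & G 1 1 = 0.
Proof.
move=> a0 b0 dE1 dE2 n0 nP; set q := stage_scale j.
have q0 : (0 < q)%N by exact: stage_scale_gt0.
have [F [Fb F1 Fev Fsupp Fpsd]] :=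
  window_kernel _ _ _ _ (q * q * j * `|n|)%N a0 b0 dE1 dE2.
pose D := dilations j.+1 j; pose T : R := (j.+1 ^ j)%:R.
have T0 : 0 < T by rewrite ltr0n expn_gt0.
have TE : T = \sum_(c <- D) 1.
  by rewrite big_const_seq count_predT iter_addr_0 size_dilations.
have cn c : c \in D -> c%:R != 0 :> rat.
  by move=> /dilations_gt0; rewrite pnatr_eq0 -lt0n.
pose h x y (c : nat) := F (q%:R * c%:R * x) (n%:~R * q%:R * y / c%:R).
have h01 x y c : 0 <= h x y c <= 1.
  by case/andP: (Fb (q%:R * c%:R * x) (n%:~R * q%:R * y / c%:R)) => -> /le_trans; apply.
exists (fun x y => (\sum_(c <- D) h x y c) / T); [split|].
- move=> x y; rewrite divr_ge0 ?(ltW T0)//=; last first.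
    by apply: sumr_ge0 => c _; case/andP: (h01 x y c).
  rewrite ler_pM2r ?invr_gt0//; apply: ler_sum => c _.
  by rewrite /h !mulr0 mul0r; case/andP: (Fb (q%:R * c%:R * x) (n%:~R * q%:R * y / c%:R)).
- rewrite ler_pdivrMr// mul1r TE; apply: ler_sum => c _.
  by case/andP: (h01 0 0 c).
- move=> x y; congr (_ / _); apply: eq_bigr => c _.
  by rewrite /h !mulrN mulNr Fev.
- move=> m x y mj; rewrite -mulrBl normrM normfV (gtr0_norm T0) ler_pdivrMr//.
  rewrite [leRHS]mulrC ler_pdivlMr ?ltr0n// mulrC.
  have := dilations_folner j.+1 j m (h x y) (h01 x y) mj.
  rewrite -/D -/T; congr (_ * `|_ - _| <= _); apply: eq_big_seq => c cD.
  rewrite /h natrM; congr (F _ _); first by ring.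
  by field; rewrite cn// pnatr_eq0 -lt0n; case/andP: mj => ->.
- move=> u uadm.
  pose uc (c : nat) : seq (R * (rat * rat)) :=
    [seq (a.1, (q%:R * c%:R * a.2.1, n%:~R * q%:R * a.2.2 / c%:R)) | a <- u].
  have -> : gram (fun x y => (\sum_(c <- D) h x y c) / T) u u =
      (\sum_(c <- D) gram F (uc c) (uc c)) / T.
    rewrite /gram (eq_bigr (fun c => \sum_(a <- u) \sum_(b <- u) a.1 * b.1 *
       h (a.2.1 - b.2.1) (a.2.2 - b.2.2) c)); last first.
      move=> c _; rewrite /uc big_map; apply: eq_bigr => a _.
      rewrite big_map; apply: eq_bigr => b _ /=; congr (_ * F _ _); ring.
    rewrite [in RHS]exchange_big big_distrl /=; apply: eq_bigr => a _.
    rewrite [in RHS]exchange_big big_distrl /=; apply: eq_bigr => b _.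
    by rewrite mulrA big_distrr.
  rewrite ler_pdivlMr// TE big_distrr /= big_seq [leRHS]big_seq.
  apply: ler_sum => c cD; rewrite mulr1.
  have -> : mass u = mass (uc c) by rewrite /mass /uc big_map.
  apply: Fpsd => _ /mapP[a au ->] /=.
  have [P qP] := dvdn_stage_scale _ _ cD.
  have c0 := dilations_gt0 _ _ _ cD.
  have cq : (c <= q)%N by apply: dvdn_leq => //; rewrite /q qP mulnA dvdn_mull.
  move: (uadm _ au) => /andP[/andP[xi xj] /andP[yi yj]].
  have : q%:R * c%:R * a.2.1 \is a Num.int.
    rewrite /q qP (_ : _ * _ = (P * c * c)%:R * (j`!%:R * a.2.1)); last first.
      by rewrite !natrM; ring.
    by rewrite rpredM// natr_int.
  move=> /intrP[X XE].
  have : n%:~R * q%:R * a.2.2 / c%:R \is a Num.int.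
    rewrite /q qP (_ : _ / _ = n%:~R * P%:R * (j`!%:R * a.2.2)); last first.
      by rewrite !natrM; field; exact: cn.
    by rewrite rpredM// rpredM ?natr_int// intr_int.
  move=> /intrP[Y YE].
  have bd (m : int) (B : nat) : `|m%:~R| <= B%:R :> rat -> `|m| <= B%:Z.
    by rewrite -intr_norm pmulrn ler_int.
  have n1 : (0 < `|n|)%N by rewrite absz_gt0.
  exists X, Y; split; first by rewrite XE YE.
    apply: bd; rewrite -XE !normrM !normr_nat.
    apply: le_trans (_ : q%:R * q%:R * j%:R <= _).
      by rewrite ler_pM ?mulr_ge0// ler_wpM2l// ler_nat.
    by rewrite -!natrM ler_nat leq_pmulr.
  apply: bd; rewrite -YE !normrM normfV !normr_nat.
  apply: le_trans (_ : `|n%:~R| * q%:R * j%:R <= _).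
    rewrite ler_pdivrMr ?ltr0n//; apply: le_trans (_ : _ <= `|n%:~R| * q%:R * j%:R * 1) _.
      by rewrite mulr1 ler_wpM2l// mulr_ge0.
    by rewrite ler_wpM2l ?ler1n// !mulr_ge0.
  rewrite -intr_norm -abszE -pmulrn -!natrM ler_nat.
  by rewrite -mulnA mulnC leq_mul// leq_mul// leq_pmulr.
- rewrite big_seq big1 ?mul0r// => c cD; apply: contra_notP nP => /eqP.
  rewrite /h !mulr1 => /Fsupp[m [m' [e1 e2 E1m E2m']]].
  exists m => //; exists m' => //; apply: (@intr_inj rat).
  rewrite !intrM -e1 -e2 -pmulrn natrX -/q; field; exact: cn.
Qed.

(** * Passing to the limit *)

Lemma ultra_cvg01 {R : realType} (U : set_system nat) (h : nat -> R) :
  UltraFilter U -> (forall j, 0 <= h j <= 1) -> exists l : R, h @ U --> l.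
Proof.
move=> UU h01; have PU : ProperFilter U by exact: ultra_proper.
have hU : (h @ U) `[0, 1]%classic by apply: nearW => j /=; rewrite in_itv/= h01.
have [l [_ cl]] := @segment_compact R 0 1 (h @ U) _ hU.
exists l => A Al; have [//|UnA] := in_ultra_setVsetC (h @^-1` A) UU.
have [y [nAy Ay]] : (~` A) `&` A !=set0 by apply: cl => //.
by [].
Qed.

Lemma admissible_near (u : seq rat) :
  \forall j \near \oo, forall x, x \in u -> admissible j x.
Proof.
elim: u => [|x u IH]; first by apply: nearW.
have hx : \forall j \near \oo, admissible j x.
  exists (maxn `|denq x|%N (Num.bound `|x|)) => // j /=; rewrite geq_max => /andP[dj bj].
  apply/andP; split; last first.
    apply: le_trans (ltW (archi_boundP (normr_ge0 x))) _.
    by rewrite ler_nat.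
  have /dvdnP[m mE] : (`|denq x| %| j`!)%N.
    by rewrite dvdn_fact// absz_gt0 denq_neq0 dj.
  have dE : (`|denq x|%N)%:R = (denq x)%:~R :> rat by rewrite pmulrn gez0_abs// denq_ge0.
  by rewrite mE natrM dE -mulrA [_ * x]mulrC -numqE rpredM ?intr_int ?natr_int.
near=> j => y; rewrite inE => /orP[/eqP->|]; first by near: j.
by move: y; near: j.
Unshelve. all: by end_near. Qed.

(** Every condition involves finitely many values of the kernel and holds at
    all late stages, up to an error that tends to 0.  The ultrafilter makes all
    values converge at once. *)
Lemma limit_kernel {R : realType} (d : R) (G : nat -> rat -> rat -> R) :
  (forall j, stage_kernel d j (G j)) -> (forall j, G j 1 1 = 0) ->
  exists2 H, dilation_kernel d H & H 1 1 = 0.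
Proof.
move=> GP G1; have [U [UU sU]] := ultraFilterLemma eventually_filter.
have PU : ProperFilter U by exact: ultra_proper.
have /choice[H HP] : forall p : rat * rat, exists l : R,
    (fun j => G j p.1 p.2) @ U --> l.
  move=> p; apply: ultra_cvg01 => j.
  case/andP: (stage_bounds _ _ _ (GP j) p.1 p.2) => -> /le_trans; apply.
  exact: stage_origin_le1 (GP j).
have {}HP x y : G j x y @[j --> U] --> H (x, y) by exact: (HP (x, y)).
exists (fun x y => H (x, y)); last first.
  apply: (cvg_unique (@norm_hausdorff _ R^o) (HP 1 1)).
  rewrite (_ : (fun j => _) = fun=> 0); first exact: cvg_cst.
  by apply/funext => j; exact: G1.
split.
- move=> x y; apply: (cvgr_to_ge (HP x y)); apply: nearW => j.
  by case/andP: (stage_bounds _ _ _ (GP j) x y).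
- move=> x y; apply: (ler_cvg_to (HP x y) (HP 0 0)); apply: nearW => j.
  by case/andP: (stage_bounds _ _ _ (GP j) x y).
- apply: (cvgr_to_le (HP 0 0)); apply: nearW => j.
  exact: stage_origin_le1 (GP j).
- move=> x y; apply: (cvg_unique (@norm_hausdorff _ R^o) (HP _ _)).
  rewrite (_ : (fun j => _) = fun j => G j x y); first exact: HP.
  by apply/funext => j; exact: stage_even (GP j) _ _.
- move=> c x y c0; apply/eqP; rewrite -subr_eq0 -normr_le0; apply/ler_addgt0Pr => e e0.
  rewrite add0r.
  apply: (cvgr_to_le (cvg_norm (cvgB (HP (c%:R * x) (y / c%:R)) (HP x y)))).
  apply: sU; near=> j.
  have inv := stage_dilate _ _ _ (GP j).
  apply: le_trans (inv c x y _) _; first by rewrite c0 /=; near: j; exact: nbhs_infty_ge.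
  rewrite -[leRHS]invrK lef_pV2 ?posrE ?invr_gt0//.
  apply: (@le_trans _ _ j%:R); last by rewrite ler_nat.
  by near: j; exact: nbhs_infty_ger.
- move=> u.
  have cv : gram (G j) u u @[j --> U] --> gram (fun x y => H (x, y)) u u.
    rewrite /gram; apply: cvg_big => [|a _]; first exact: add_continuous.
    apply: cvg_big => [|b _]; first exact: add_continuous.
    by apply: cvgM; [exact: cvg_cst|exact: HP].
  apply: (cvgr_to_ge cv); apply: sU; near=> j.
  apply: (stage_mass _ _ _ (GP j)) => a au.
  apply/andP; split.
    have : a.2.1 \in [seq a.2.1 | a <- u] by exact: map_f.
    by move: a.2.1 {au}; near: j; exact: admissible_near.
  have : a.2.2 \in [seq a.2.2 | a <- u] by exact: map_f.
  by move: a.2.2 {au}; near: j; exact: admissible_near.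
Unshelve. all: by end_near. Qed.

Lemma density_nonempty {R : realType} (E : set int) (alpha : R) :
  0 < alpha -> upper_banach_density R E = alpha%:E -> exists e, E e.
Proof.
move=> a0 /(density_window _ _ 0 a0)[N [a [[|s S] [_ N0 _ SE sz]]]].
  have : 0 < alpha / 2 * N%:R by rewrite !mulr_gt0 ?ltr0n ?invr_gt0.
  by rewrite ltNge sz.
by exists s; have [] := SE s (mem_head s S).
Qed.

Theorem corollary1p1 (R : realType) :
  forall alpha beta : R, 0 < alpha <= 1 -> 0 < beta <= 1 ->
  exists k0 : nat, (0 < k0)%N /\
    forall E1 E2 : set int,
      upper_banach_density R E1 = alpha%:E ->
      upper_banach_density R E2 = beta%:E ->
      exists k : int, 1 <= k <= k0%:Z /\
        multiples k `<=` prod_set (diff_set E1) (diff_set E2).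
Proof.
move=> alpha beta /andP[a0 _] /andP[b0 _]; apply: contrapT => nk.
pose d := (alpha * beta) ^+ 2 / 144.
have d0 : 0 < d by rewrite divr_gt0 ?exprn_gt0 ?mulr_gt0.
suff /choice[G GP] : forall j, exists G, stage_kernel d j G /\ G 1 1 = 0.
  have [H HK H1] := limit_kernel d G (fun j => (GP j).1) (fun j => (GP j).2).
  by have := ker_11_gt0 _ _ d0 HK; rewrite H1 ltxx.
move=> j; apply: contrapT => nG; apply: nk.
(* If stage j has no kernel, then k0 = k = q^2 works for all E1 and E2. *)
exists (stage_scale j ^ 2)%N; split; first by rewrite expn_gt0 stage_scale_gt0.
move=> E1 E2 dE1 dE2; exists (stage_scale j ^ 2)%N%:Z; split.
  by rewrite lexx andbT lez_nat expn_gt0 stage_scale_gt0.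
move=> _ [n _ <-]; have [->|n0] := eqVneq n 0.
  have D0 (E : set int) (a : R) : 0 < a -> upper_banach_density R E = a%:E -> diff_set E 0.
    move=> a_gt0 /(density_nonempty _ _ a_gt0)[e Ee].
    by exists e => //; exists e => //; exact: subrr.
  rewrite mulr0; exists 0; first exact: D0 dE1.
  by exists 0; [exact: D0 dE2|exact: mul0r].
apply: contrapT => nP; apply: nG.
by have [G GK G1] := approx_kernel E1 E2 alpha beta j n a0 b0 dE1 dE2 n0 nP; exists G.
Qed.
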